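(* Let $\sigma^2 > 0$ and $0 < \beta < 1$ be fixed. Then $\lambda(0, v, \sigma^2, \beta)/\sqrt{v}$ is nondecreasing as a function of $v \in (0,\infty)$.
   Context: For $u \in \mathbb{R}$, $v>0$, $\sigma^2>0$ and $0<\beta<1$, let $\theta$ be a random variable with prior distribution $\pi = N(u,v)$ (mean $u$, variance $v$) and, conditionally on $\theta$, let $X_1, X_2, \ldots$ be i.i.d. $N(\theta,\sigma^2)$ (the variance $\sigma^2$ is known). The Gittins index of this normal reward process is $$\lambda(u,v,\sigma^2,\beta) = \sup_{\xi \geq 1}\left[ E_\pi E_\theta\left(\sum_{n=1}^{\xi} \beta^{n-1} X_n\right) \bigg/ E_\pi E_\theta\left(\sum_{n=1}^{\xi} \beta^{n-1}\right)\right],$$ where the supremum is over all integer-valued stopping times $\xi \ge 1$ with respect to the filtration generated by $X_1, X_2, \ldots$. Here $E_\theta$ is the conditional expectation given $\theta$ and $E_\pi$ is the expectation over $\theta\sim\pi$, so $E_\pi E_\theta$ is the overall expectation. *)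

(* Defs.v *)
From HB Require Import structures.
From mathcomp Require Import all_boot all_order all_algebra.
From mathcomp Require Import all_classical all_reals all_analysis.

Set Implicit Arguments.
Unset Strict Implicit.
Unset Printing Implicit Defensive.

Import Order.TTheory GRing.Theory Num.Theory.

Local Open Scope classical_set_scope.
Local Open Scope ring_scope.
Local Open Scope ereal_scope.

(* Observations are indexed from 0: [X n] stands for X_{n+1}. *)

(* [theta] ~ N(u, v) and, given [theta], the [X n] are i.i.d. N(theta, s2).
   The second law is the defining property of the conditional probability
     P(X_1 \in B_0, ..., X_n \in B_{n-1} | theta)
       = \prod_(i < n) N(theta, s2)(B_i),
   integrated over the events [theta \in A].  [normal_prob] takes the standard
   deviation, and laws are compared on measurable sets only, since the value of
   a measure elsewhere is meaningless. *)
Definition normal_reward_process (R : realType) (d : measure_display)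
    (T : measurableType d) (P : probability T R)
    (theta : {RV P >-> R}) (X : nat -> {RV P >-> R}) (u v s2 : R) : Prop :=
  (forall A : set R, measurable A ->
     P (theta @^-1` A) = normal_prob u (Num.sqrt v) A) /\
  (forall (n : nat) (A : set R) (B : nat -> set R),
     measurable A -> (forall i, measurable (B i)) ->
     P (theta @^-1` A `&` \bigcap_(i < n) (X i @^-1` B i)) =
     \int[P]_(w in theta @^-1` A)
        \prod_(i < n) normal_prob (theta w) (Num.sqrt s2) (B i)).

(* The sigma-algebra generated by the first [n] observations X_1, ..., X_n. *)
Definition natural_filtration (R : realType) (d : measure_display)
    (T : measurableType d) (P : probability T R)
    (X : nat -> {RV P >-> R}) (n : nat) : set (set T) :=
  <<s \bigcup_(i < n) preimage_set_system setT (X i) measurable >>.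

Definition stopping_time (T : Type) (F : nat -> set (set T))
    (xi : T -> nat) : Prop :=
  forall n : nat, F n [set w | (xi w <= n)%N].

Definition gittins_index (R : realType) (d : measure_display)
    (T : measurableType d) (P : probability T R)
    (X : nat -> {RV P >-> R}) (b : R) : \bar R :=
  ereal_sup
    [set 'E_P[fun w => (\sum_(n < xi w) b ^+ n * X n w)%R] /
         'E_P[fun w => (\sum_(n < xi w) b ^+ n)%R] | xi in
      [set xi : T -> nat |
        stopping_time (natural_filtration X) xi /\
        forall w, (1 <= xi w)%N]].

(* Main.v *)
Require Import Defs.
From HB Require Import structures.
From mathcomp Require Import all_boot all_order all_algebra.
From mathcomp Require Import all_classical all_reals all_analysis.
From mathcomp Require Import measurable_realfun.
From mathcomp Require Import ring lra.
Import Order.TTheory GRing.Theory Num.Theory.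
Local Open Scope classical_set_scope.
Local Open Scope ring_scope.

(** Dividing rewards by [sqrt v] turns a normal reward process with prior
    [N(0, v)] and noise variance [s2] into one with prior [N(0, 1)] and noise
    variance [s2 / v].  So a larger [v] amounts to more accurate observations
    of the same standard normal mean, and the theorem says that accuracy can
    only help: a decision maker who sees the accurate observations can add
    independent noise to them, and so imitate any stopping time of the less
    accurate process.

    The proof keeps the prior [N(0, v1)] and compares [X1] with [a * X2], where
    [a = sqrt v1 / sqrt v2 <= 1].  Given its mean, the latter has noise standard
    deviation [a * sqrt s2 <= sqrt s2].  If [g] is the index of [X2], then no
    stopping time makes a profit on [a * X2] when each observation is charged
    [a * g]; it has to be shown that the same charge makes [X1] unprofitable,
    for this bounds the index of [X1] by [a * g].

    Stopping times are replaced by stopping rules, which are decreasing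
    sequences of sets of real sequences ([rule_stopping_time],
    [stopping_time_rule]); in this form they can be moved from one process to
    another.  For a fixed horizon [N] the noise is added to one observation at a
    time ([noise_step]): this enlarges the probability space by a factor [R]
    with a centred normal law.  For each value [z] of the noise, the rule
    applied to the noisy path is a rule for the original process, so by Fubini's
    theorem its gain is at most the mean of the extra reward [z] collected at
    the noisy observation.  The decision to take that observation only looks at
    earlier ones, hence is independent of [z], and the extra reward has mean
    zero.

    After [N] steps the noisy process has the law of the first [N] observations
    of [X1], because normal laws convolve ([normal_prob_conv]) and the boxes
    form a pi-system ([integral_eq_law]); this is [unprofitable_noisier].
    Dominated convergence then removes the horizon ([integral_stopped]). *)

(** * Affine images and convolution of normal laws *)

(** The measure structure of a pushforward depends on a proof of
    measurability, which type inference does not find; here it is an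
    argument. *)
Definition image_measure {d d'} {T : measurableType d} {T' : measurableType d'}
    {R : realType} (mu : {measure set T -> \bar R}) {f : T -> T'}
    (mf : measurable_fun setT f) : {measure set T' -> \bar R} :=
  measure_function_pushforward__canonical__measure_function_Measure mu mf.

Section gauss.
Context {R : realType}.
Implicit Types (m s t a z : R) (B : set R).
Local Notation mu := (@lebesgue_measure R).

Lemma measurable_affine a z : measurable_fun setT (fun x : R => a * x + z).
Proof. by apply: measurable_funD => //; exact: measurable_funM. Qed.

Lemma measurable_affine_preimage a z B : measurable B ->
  measurable ((fun x : R => a * x + z) @^-1` B).
Proof.
by move=> mB; rewrite -[X in measurable X]setTI; exact: measurable_affine.
Qed.

Lemma lebesgue_measure_affine a z B : 0 < a -> measurable B ->
  (mu B = a%:E * mu ((fun x => a * x + z)%R @^-1` B))%E.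
Proof.
move=> a0 mB.
pose f : measurableTypeR R -> measurableTypeR R := fun x => a * x + z.
have mf : measurable_fun setT f by exact: measurable_affine.
pose nu := mscale (NngNum (ltW a0)) (image_measure mu mf).
suff : mu B = nu B by [].
apply: lebesgue_measure_unique mB => //= _ [[b c]] _ <-.
rewrite /nu /mscale/= /pushforward/=.
have -> : f @^-1` `]b, c] = `](b - z) / a, (c - z) / a]%classic.
  apply/seteqP; split=> x /=; rewrite !in_itv/= /f ltr_pdivrMr// ler_pdivlMr//;
  by rewrite ltrBlDr lerBrDr (mulrC x).
rewrite !lebesgue_measure_itv/= !lte_fin ltr_pM2r ?invr_gt0// ltrD2r.
case: ifP => _; last by rewrite mule0.
rewrite -!EFinD -EFinM -mulrBl opprD opprK addrACA (addrC (- z)) subrr addr0.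
by rewrite mulrC divfK// gt_eqF.
Qed.

Lemma ge0_integral_affine a z B (h : R -> \bar R) : 0 < a -> measurable B ->
  measurable_fun setT h -> (forall x, 0 <= h x)%E ->
  (\int[mu]_(x in B) h x =
   a%:E * \int[mu]_(x in (fun x => a * x + z)%R @^-1` B) h (a * x + z)%R)%E.
Proof.
move=> a0 mB mh h0.
pose f : measurableTypeR R -> measurableTypeR R := fun x => a * x + z.
have mf : measurable_fun setT f by exact: measurable_affine.
transitivity (\int[mscale (NngNum (ltW a0)) (image_measure mu mf)]_(x in B) h x)%E.
  apply: eq_measure_integral => /= A mA _; exact: lebesgue_measure_affine.
rewrite ge0_integral_mscale//; last exact: measurable_funTS.
rewrite ge0_integral_pushforward//.
exact: measurable_funTS.
Qed.

Lemma normal_peakM a s : 0 < a -> normal_peak (a * s) = a^-1 * normal_peak s.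
Proof.
move=> a0; rewrite /normal_peak exprMn -mulrA -mulrnAr sqrtrM ?sqr_ge0//.
by rewrite sqrtr_sqr gtr0_norm// invfM.
Qed.

Lemma normal_pdf_affine m s a z x : 0 < a -> s != 0 ->
  normal_pdf m s x = a * normal_pdf (a * m + z) (a * s) (a * x + z).
Proof.
move=> a0 s0; have aN0 : a != 0 by rewrite gt_eqF.
rewrite !normal_pdfE ?mulf_neq0// mulrA; congr (_ * _).
  by rewrite normal_peakM// mulrA mulfV// mul1r.
rewrite /normal_fun; congr expR.
have -> : a * x + z - (a * m + z) = a * (x - m) by ring.
by field; rewrite s0 aN0.
Qed.

Lemma normal_prob_affine m s a z B : 0 < a -> s != 0 -> measurable B ->
  normal_prob m s ((fun x => a * x + z) @^-1` B) =
  normal_prob (a * m + z) (a * s) B.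
Proof.
move=> a0 s0 mB; rewrite /normal_prob [RHS](ge0_integral_affine a z)//; last 2 first.
- apply/measurable_EFinP; exact: measurable_normal_pdf.
- by move=> x; rewrite lee_fin normal_pdf_ge0.
rewrite -ge0_integralZl//; first last.
- by rewrite lee_fin ltW.
- by move=> x _; rewrite lee_fin normal_pdf_ge0.
- apply: measurable_funTS; apply/measurable_EFinP; apply: measurableT_comp.
    exact: measurable_normal_pdf. exact: measurable_affine.
- exact: measurable_affine_preimage.
by apply: eq_integral => x _; rewrite -EFinM -normal_pdf_affine.
Qed.

(** The density is a version of the Radon-Nikodym derivative of the normal law,
    so the change of variables formula for the latter applies. *)
Lemma ge0_integral_normal_prob m s (f : R -> \bar R) :
  measurable_fun setT f -> (forall x, 0 <= f x)%E ->
  (\int[normal_prob m s]_x f x = \int[mu]_x (f x * (normal_pdf m s x)%:E))%E.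
Proof.
move=> mf f0; have dom := normal_prob_dominates m s.
rewrite -(Radon_Nikodym_SigmaFinite.change_of_variables dom f0)//.
apply: ae_eq_integral => //.
- apply: emeasurable_funM => //; apply: measurable_int.
  exact: (Radon_Nikodym_SigmaFinite.f_integrable dom).
- apply: emeasurable_funM => //; apply/measurable_EFinP.
  exact: measurable_normal_pdf.
apply: ae_eqe_mul2l; apply: integral_ae_eq => //.
- exact: (Radon_Nikodym_SigmaFinite.f_integrable dom).
- apply/measurable_EFinP; exact: measurable_normal_pdf.
by move=> A _ mA; rewrite -Radon_Nikodym_SigmaFinite.f_integral.
Qed.

Lemma measurable_normal_pdf2 t : t != 0 ->
  measurable_fun setT (fun p : R * R => (normal_pdf p.1 t p.2)%:E).
Proof.
move=> t0; apply/measurable_EFinP.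
rewrite (_ : (fun p => _) = fun p : R * R => normal_pdf 0 t (p.2 - p.1)); last first.
  by apply/funext => p; rewrite !normal_pdfE// /normal_fun subr0.
apply: measurableT_comp; first exact: measurable_normal_pdf.
exact: measurable_funB.
Qed.

(** A parameterized integral of the jointly measurable [measurable_normal_pdf2];
    it makes the normal laws with fixed deviation usable as a kernel in the
    mean. *)
Lemma measurable_normal_prob_mean t B : t != 0 -> measurable B ->
  measurable_fun setT (fun m => normal_prob m t B).
Proof.
move=> t0 mB; rewrite /normal_prob.
under eq_fun do rewrite integral_mkcond epatch_indic.
apply: (@measurable_fun_fubini_tonelli_F _ _ _ _ R mu
  (fun p : R * R => (normal_pdf p.1 t p.2)%:E * (\1_B p.2)%:E)%E) => [|p].
  apply: emeasurable_funM; first exact: measurable_normal_pdf2.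
  by apply/measurable_EFinP; apply: (@measurableT_comp _ _ _ _ _ _ (\1_B : R -> R) _ snd) => //;
    exact: measurable_indic.
by rewrite -EFinM lee_fin mulr_ge0// normal_pdf_ge0.
Qed.

(** Completing the square in [y]: the joint density of a centred normal [y] and
    of [x] given [y] is the marginal density of [x] times the density of [y]
    given [x]. *)
Lemma normal_pdf_conv s t x y : 0 < s -> 0 < t ->
  let r := Num.sqrt (s ^+ 2 + t ^+ 2) in
  normal_pdf 0 s y * normal_pdf y t x =
  normal_pdf 0 r x * normal_pdf (s ^+ 2 / r ^+ 2 * x) (s * t / r) y.
Proof.
move=> s0 t0 r.
have r2 : r ^+ 2 = s ^+ 2 + t ^+ 2 by rewrite sqr_sqrtr// addr_ge0// sqr_ge0.
have r0 : 0 < r by rewrite sqrtr_gt0 addr_gt0// exprn_gt0.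
have sN0 : s != 0 by rewrite gt_eqF.
have tN0 : t != 0 by rewrite gt_eqF.
have rN0 : r != 0 by rewrite gt_eqF.
rewrite !normal_pdfE ?mulf_neq0 ?invr_eq0// mulrACA [RHS]mulrACA; congr (_ * _).
  have E (c : R) : 0 < c -> normal_peak c = c^-1 * normal_peak 1.
    by move=> c0; rewrite -normal_peakM// mulr1.
  rewrite (E s)// (E t)// (E r)// (E (s * t / r)) ?divr_gt0 ?mulr_gt0//.
  by field; rewrite sN0 tN0 rN0.
rewrite /normal_fun -!expRD; congr expR.
rewrite !exprMn exprVn r2.
have D0 : s ^+ 2 + t ^+ 2 != 0 by rewrite -r2 expf_neq0.
by field; rewrite sN0 tN0 D0.
Qed.

Lemma normal_prob_conv s t B : 0 < s -> 0 < t -> measurable B ->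
  (\int[normal_prob 0%R s]_y normal_prob y t B =
   normal_prob 0%R (Num.sqrt (s ^+ 2 + t ^+ 2)) B)%E.
Proof.
move=> s0 t0 mB; have tN0 : t != 0 by rewrite gt_eqF.
rewrite ge0_integral_normal_prob//; last exact: measurable_normal_prob_mean.
pose r := Num.sqrt (s ^+ 2 + t ^+ 2).
transitivity (\int[mu]_y \int[mu]_x
    ((normal_pdf 0 r x)%:E * (normal_pdf (s ^+ 2 / r ^+ 2 * x) (s * t / r) y)%:E
     * (\1_B x)%:E))%E.
  apply: eq_integral => y _; rewrite /normal_prob integral_mkcond epatch_indic.
  rewrite muleC -ge0_integralZl//; last 3 first.
  - apply: emeasurable_funM; apply/measurable_EFinP.
      exact: measurable_normal_pdf.
    exact: measurable_indic.
  - by move=> x _; rewrite -EFinM lee_fin mulr_ge0// normal_pdf_ge0.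
  - by rewrite lee_fin normal_pdf_ge0.
  by apply: eq_integral => x _; rewrite muleA -!EFinM (normal_pdf_conv s t x y s0 t0).
pose f (p : R * R) := ((normal_pdf 0 r p.2)%:E *
  (normal_pdf (s ^+ 2 / r ^+ 2 * p.2) (s * t / r) p.1)%:E * (\1_B p.2)%:E)%E.
have mf : measurable_fun setT f.
  rewrite (_ : f = fun p : R * R => ((normal_pdf 0 s p.1)%:E *
     (normal_pdf p.1 t p.2)%:E * (\1_B p.2)%:E)%E).
    apply: emeasurable_funM; last first.
      by apply/measurable_EFinP; apply: (@measurableT_comp _ _ _ _ _ _ (\1_B : R -> R) _ snd) => //;
        exact: measurable_indic.
    apply: emeasurable_funM; last exact: measurable_normal_pdf2.
    by apply/measurable_EFinP; apply: (@measurableT_comp _ _ _ _ _ _ (normal_pdf 0 s) _ fst) => //;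
      exact: measurable_normal_pdf.
  by apply/funext => p; rewrite /f -!EFinM (normal_pdf_conv s t p.2 p.1 s0 t0).
have f0 p : (0 <= f p)%E.
  by rewrite /f -!EFinM lee_fin !mulr_ge0// normal_pdf_ge0.
transitivity (\int[mu]_x \int[mu]_y f (y, x))%E.
  exact: (@fubini_tonelli _ _ _ _ R mu mu f mf f0).
rewrite /f/=.
rewrite /normal_prob [RHS]integral_mkcond epatch_indic.
apply: eq_integral => x _.
under eq_integral do rewrite muleAC.
rewrite ge0_integralZl//; last 3 first.
- apply/measurable_EFinP; exact: measurable_normal_pdf.
- by move=> y _; rewrite lee_fin normal_pdf_ge0.
- by rewrite -EFinM lee_fin mulr_ge0// normal_pdf_ge0.
by rewrite integral_normal_pdf mule1.
Qed.

Lemma normal_prob0N s B : s != 0 -> measurable B ->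
  normal_prob 0 s (-%R @^-1` B) = normal_prob 0 s B.
Proof.
move=> s0 mB; rewrite /normal_prob.
have mN : measurable_fun setT (-%R : measurableTypeR R -> measurableTypeR R).
  exact: oppr_measurable.
transitivity (\int[image_measure mu mN]_(x in B) (normal_pdf 0 s x)%:E)%E; last first.
  by apply: eq_measure_integral => A mA _; exact: lebesgue_measureN.
have mf : measurable_fun B (fun x => (normal_pdf 0 s x)%:E).
  by apply: measurable_funTS; apply/measurable_EFinP; exact: measurable_normal_pdf.
have f0 : {in B, forall x, 0 <= (normal_pdf 0 s x)%:E}%E.
  by move=> x _; rewrite lee_fin normal_pdf_ge0.
rewrite (ge0_integral_pushforward mN mu mB mf f0).
by apply: eq_integral => x _ /=; rewrite !normal_pdfE// /normal_fun !subr0 sqrrN.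
Qed.

(** The factor [|x|] is absorbed by half of the Gaussian exponent, which leaves
    a multiple of the normal density of deviation [sqrt 2 * s]. *)
Lemma integrable_normal_prob0 s : 0 < s ->
  (normal_prob 0 s).-integrable setT (fun x => x%:E).
Proof.
move=> s0; apply/integrableP; split; first exact/measurable_EFinP.
rewrite (ge0_integral_normal_prob 0 s (fun x => `|x%:E|%E))//; last first.
  by do 2 apply: measurableT_comp => //.
have r0 : 0 < Num.sqrt 2 :> R by rewrite sqrtr_gt0.
pose r := Num.sqrt 2 * s.
have rs0 : 0 < r by rewrite mulr_gt0.
pose C := 2 * s * normal_peak s / normal_peak r.
have C0 : 0 <= C by rewrite divr_ge0 ?normal_peak_ge0// mulr_ge0 ?normal_peak_ge0// mulr_ge0// ltW.
apply: (@le_lt_trans _ _ (\int[mu]_x (C%:E * (normal_pdf 0 r x)%:E))%E); last first.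
  rewrite ge0_integralZl//; last 2 first.
  - apply/measurable_EFinP; exact: measurable_normal_pdf.
  - by move=> x _; rewrite lee_fin normal_pdf_ge0.
  by rewrite integral_normal_pdf mule1 ltry.
apply: ge0_le_integral => //.
- by move=> x _; rewrite -EFinM lee_fin mulr_ge0// normal_pdf_ge0.
- apply/measurable_EFinP; apply: measurable_funM; first exact: normr_measurable.
  exact: measurable_normal_pdf.
- apply/measurable_EFinP; apply: measurable_funM => //.
  exact: measurable_normal_pdf.
move=> x _; rewrite -EFinM lee_fin.
rewrite !normal_pdfE ?gt_eqF// /C [leRHS]mulrA divfK ?gt_eqF ?normal_peak_gt0 ?gt_eqF//.
rewrite mulrCA -[leRHS]mulrA [leRHS]mulrCA; apply: ler_wpM2l; first exact: normal_peak_ge0.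
rewrite /normal_fun !subr0.
(* half of the exponent is kept, the other half has to dominate |x| *)
have e : - x ^+ 2 / (s ^+ 2 *+ 2) = - x ^+ 2 / (r ^+ 2 *+ 2) - (x / (2 * s)) ^+ 2.
  rewrite /r exprMn sqr_sqrtr//; field; rewrite gt_eqF//.
rewrite e expRD mulrCA [leRHS]mulrC; apply: ler_wpM2l; first exact: expR_ge0.
rewrite expRN ler_pdivrMr ?expR_gt0//.
have -> : `|x| = 2 * s * `|x / (2 * s)|.
  by rewrite normrM normfV (gtr0_norm (mulr_gt0 _ s0))// mulrC divfK// mulf_neq0// gt_eqF.
apply: ler_wpM2l; first by rewrite mulr_ge0// ltW.
(* |u| <= 1 + u ^ 2 <= exp (u ^ 2) *)
apply: le_trans (expR_ge1Dx _).
rewrite -real_normK ?num_real//; set u := `|_|.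
have u0 : 0 <= u by exact: normr_ge0.
by have := sqr_ge0 (u - 1); nra.
Qed.

Lemma integral_normal_prob0 s : 0 < s ->
  (\int[normal_prob 0%R s]_x x%:E = 0)%E.
Proof.
move=> s0; have iX := integrable_normal_prob0 s s0.
have mN : measurable_fun setT (-%R : measurableTypeR R -> measurableTypeR R).
  exact: oppr_measurable.
have E : (\int[normal_prob 0%R s]_x x%:E = - \int[normal_prob 0%R s]_x x%:E)%E.
  transitivity (\int[image_measure (normal_prob 0 s) mN]_x x%:E)%E.
    apply: eq_measure_integral => A mA _; rewrite /= /pushforward.
    by rewrite normal_prob0N// gt_eqF.
  rewrite integral_pushforward//=.
  - by rewrite -integralN//; exact: integrable_add_def.
  - by rewrite preimage_setT; exact: integrableN iX.
have := integrable_fin_num measurableT iX.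
by case: (\int[_]_x _)%E E => //= r [] rE _; congr (_%:E); lra.
Qed.

(** The law of the noise that lowers the accuracy of an observation from [t2] to
    [t1].  It is normal with variance [t1 ^+ 2 - t2 ^+ 2] when this is positive;
    for [t1 = t2] it is the Dirac mass at [0], since [normal_prob _ 0] is by
    convention not a point mass. *)
Lemma exists_noise t1 t2 : 0 < t2 -> t2 <= t1 ->
  exists nu : probability (measurableTypeR R) R,
  [/\ nu.-integrable setT (fun x => x%:E), (\int[nu]_x x%:E = 0)%E &
    forall m B, measurable B ->
      (\int[nu]_z normal_prob (m + z)%R t2 B = normal_prob m t1 B)%E].
Proof.
move=> t20; rewrite le_eqVlt => /orP[/eqP <-|t12].
  exists (dirac (0 : measurableTypeR R)); split.
  - apply/integrableP; split; first exact/measurable_EFinP.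
    by rewrite integral_dirac//= ?diracT ?mul1e ?normr0 ?ltry//; do 2 apply: measurableT_comp => //.
  - by rewrite integral_dirac// ?diracT ?mul1e//; exact/measurable_EFinP.
  - move=> m B mB; rewrite integral_dirac// ?diracT ?mul1e ?addr0//.
    apply: (@measurableT_comp _ _ _ _ _ _ (fun m => normal_prob m t2 B) _ (fun z => m + z)).
      by apply: measurable_normal_prob_mean => //; rewrite gt_eqF.
    exact: measurable_funD.
have D0 : 0 < t1 ^+ 2 - t2 ^+ 2.
  by rewrite subr_gt0 ltr_pXn2r// nnegrE ltW// (lt_trans t20).
pose s := Num.sqrt (t1 ^+ 2 - t2 ^+ 2).
have s0 : 0 < s by rewrite sqrtr_gt0.
have t10 : 0 < t1 by exact: lt_trans t12.
have tN0 t : 0 < t -> t != 0 by move=> ?; rewrite gt_eqF.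
have st : Num.sqrt (s ^+ 2 + t2 ^+ 2) = t1.
  by rewrite sqr_sqrtr ?(ltW D0)// subrK sqrtr_sqr gtr0_norm.
exists (normal_prob 0 s); split.
- exact: integrable_normal_prob0.
- exact: integral_normal_prob0.
- move=> m B mB.
  have E z : normal_prob (m + z) t2 B =
      normal_prob z t2 ((fun x => 1 * x + m) @^-1` B).
    by rewrite (normal_prob_affine z t2 1 m B ltr01 (tN0 _ t20) mB) !mul1r addrC.
  under eq_integral do rewrite E.
  rewrite (normal_prob_conv s t2 _ s0 t20 (measurable_affine_preimage 1 m B mB)).
  rewrite st (normal_prob_affine 0 t1 1 m B ltr01 (tN0 _ t10) mB).
  by rewrite mulr0 add0r mul1r.
Qed.

End gauss.

(** * Stopping rules on the space of real sequences *)

(** Real sequences as a type of their own, so that they can be given the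
    pointed structure over which generated sigma-algebras are types. *)
Definition path_space (R : realType) : Type := nat -> R.
HB.instance Definition _ (R : realType) := gen_eqMixin (path_space R).
HB.instance Definition _ (R : realType) := gen_choiceMixin (path_space R).
HB.instance Definition _ (R : realType) :=
  isPointed.Build (path_space R) (fun=> 0).

Section sequences.
Context {R : realType}.
Implicit Types (x y : path_space R) (A : set (path_space R)).
Local Notation path := (path_space R).

Definition coordinate_sets (n : nat) : set (set path) :=
  \bigcup_(i < n) preimage_set_system setT (fun x : path => x i) measurable.

Definition observable (n : nat) : set (set path) :=
  <<s coordinate_sets n >>.

Lemma observable_sigma_algebra n : sigma_algebra setT (observable n).
Proof. exact: smallest_sigma_algebra. Qed.

Lemma observable_coordinate n i (B : set R) : (i < n)%N -> measurable B ->
  observable n [set x : path | B (x i)].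
Proof.
move=> ni mB; apply: sub_sigma_algebra; exists i => //; exists B => //.
by rewrite setTI.
Qed.

Lemma le_observable m n : (m <= n)%N -> observable m `<=` observable n.
Proof.
move=> mn; apply: sub_smallest2r => // A [i im HA]; exists i => //=.
exact: leq_trans mn.
Qed.

Lemma sub_observable n (G : set (set path)) : sigma_algebra setT G ->
  (forall i B, (i < n)%N -> measurable B -> G [set x : path | B (x i)]) ->
  observable n `<=` G.
Proof.
move=> sG H; apply: smallest_sub => // A [i im [B mB <-]]; rewrite setTI.
exact: H.
Qed.

(** A decision that depends on the first [n] observations is a set of real
    sequences, independent of the probability space on which the observations
    live. *)
Lemma natural_filtrationE d (T : measurableType d) (P : probability T R)
    (X : nat -> {RV P >-> R}) n :
  natural_filtration X n =
  preimage_set_system setT (fun w => (X ^~ w : path)) (observable n).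
Proof.
rewrite /natural_filtration -(g_sigma_preimageE _ _ (coordinate_sets n)).
congr (<<s _ >>); rewrite /coordinate_sets [RHS]image_bigcup.
apply: eq_bigcupr => i _.
exact: (preimage_set_system_comp setT (fun w => (X ^~ w : path)) (fun x : path => x i)).
Qed.

Lemma measurable_observable {d} {T : measurableType d} (Y : nat -> T -> R) n A :
  (forall i, measurable_fun setT (Y i)) -> observable n A ->
  measurable [set w | A (fun i => Y i w)].
Proof.
move=> mY; move: A; apply: sub_observable => [|i B _ mB].
  split => [|A /= mA|F mF]; first exact: measurable0.
  - rewrite [X in measurable X](_ : _ = ~` [set w | A (Y ^~ w)]); first exact: measurableC.
    by apply/seteqP; split => w /=; [case|].
  - exact: (bigcupT_measurable (fun k => [set w | F k (Y ^~ w)]) mF).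
by rewrite /= -[X in measurable X]setTI; exact: mY.
Qed.

(** The sets that do not separate sequences with the same first [n] entries form
    a sigma-algebra. *)
Lemma observable_ext n A x y : observable n A ->
  (forall i, (i < n)%N -> x i = y i) -> A x -> A y.
Proof.
pose G : set (set path) :=
  [set A | forall x y, (forall i, (i < n)%N -> x i = y i) -> A x -> A y].
move=> nA; suff : G A by apply.
move: A nA; apply: sub_observable => [|i B ni mB u v uv /=]; last by rewrite uv.
split=> // [D GD u v uv [_ Du]|F GF u v uv [k _ Fu]].
  by split=> // Dv; apply: Du; apply: GD Dv => i /uv.
by exists k => //; exact: GF Fu.
Qed.

Definition shift_at (k : nat) (z : R) x : path :=
  fun i => if i == k then x i + z else x i.

Lemma observable_map n (f : nat -> R -> R) A :
  (forall i, measurable_fun setT (f i)) -> observable n A ->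
  observable n [set x : path | A (fun i => f i (x i))].
Proof.
move=> mf; move: A; apply: sub_observable => [|i B ni mB].
  have [s0 sC sU] := observable_sigma_algebra n.
  by split=> [|A HA|F HF]; [exact: s0|exact: (sC _ HA)|exact: (sU _ HF)].
apply: (observable_coordinate n i (f i @^-1` B)) => //.
by rewrite -[X in measurable X]setTI; exact: mf.
Qed.

Lemma observable_shift_at n k z A : observable n A ->
  observable n (shift_at k z @^-1` A).
Proof.
pose f i := if i == k then (fun r : R => 1 * r + z) else id.
move=> oA; rewrite [X in observable _ X](_ : _ = [set x | A (fun i => f i (x i))]).
  by apply: observable_map => // i; rewrite /f; case: eqP => // _; exact: measurable_affine.
apply/funext => x /=; congr A; apply/funext => i.
by rewrite /shift_at /f; case: eqP => //; rewrite mul1r.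
Qed.

(** [c n] is the event that observation [n] is taken, decided on the observations
    before it.  The condition on [c 0] is the counterpart of stopping times
    being at least [1]. *)
Definition stopping_rule (c : nat -> set path) : Prop :=
  [/\ forall n, observable n (c n), c 0%N = setT & forall n, c n.+1 `<=` c n].

Lemma stopping_rule_shift_at k z c : stopping_rule c ->
  stopping_rule (fun n => shift_at k z @^-1` c n).
Proof.
move=> [oc c0 dc]; split=> [n||n x]; first exact: observable_shift_at.
  by rewrite c0.
exact: dc.
Qed.

(** Discounted gain up to the horizon [N] when every observation is charged
    [l]. *)
Definition payoff (b l : R) (N : nat) (c : nat -> set path) x : R :=
  \sum_(n < N) b ^+ n * \1_(c n) x * (x n - l).

(** Shifting coordinate [k] has two effects: the rule becomes its shifted version,
    and [z] is added to the reward of observation [k].  The indicator in the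
    second term can be taken at [x] itself because [c k] only depends on the
    coordinates below [k]. *)
Lemma payoff_shift_at b l N c k z x : stopping_rule c -> (k < N)%N ->
  payoff b l N c (shift_at k z x) =
  payoff b l N (fun n => shift_at k z @^-1` c n) x + b ^+ k * \1_(c k) x * z.
Proof.
move=> [oc _ _] kN.
rewrite /payoff (bigD1 (Ordinal kN))//= [in RHS](bigD1 (Ordinal kN))//=.
have ck : \1_(c k) (shift_at k z x) = \1_(c k) x :> R.
  have E i : (i < k)%N -> shift_at k z x i = x i.
    by move=> ik; rewrite /shift_at ltn_eqF.
  rewrite !indicE; congr (nat_of_bool _)%:R; apply/idP/idP; rewrite !inE.
    by apply: (observable_ext _ _ _ _ (oc k)) => i /E.
  by apply: (observable_ext _ _ _ _ (oc k)) => i /E.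
rewrite ck {1}/shift_at eqxx.
rewrite (_ : \1_(shift_at k z @^-1` c k) x = \1_(c k) x :> R); last first.
  by rewrite -ck !indicE; congr (nat_of_bool _)%:R; apply/idP/idP; rewrite !inE.
rewrite [X in _ = X]addrAC; congr (_ + _); first by ring.
apply: eq_bigr => i ik; rewrite {2}/shift_at ifN//.
Qed.

Lemma measurable_payoff {d} {T : measurableType d} (Y : nat -> T -> R) b l N c :
  (forall i, measurable_fun setT (Y i)) -> stopping_rule c ->
  measurable_fun setT (fun w => payoff b l N c (fun i => Y i w)).
Proof.
move=> mY [oc _ _]; apply: measurable_sum => n.
apply: measurable_funM; last exact: measurable_funB.
apply: measurable_funM => //.
rewrite (_ : (fun w => _) = \1_[set w | c n (fun i => Y i w)]).
  by apply: measurable_indic; exact: measurable_observable.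
by apply/funext => w; rewrite !indicE; congr (nat_of_bool _)%:R; apply/idP/idP; rewrite !inE.
Qed.

Definition abs_payoff (b l : R) (N : nat) x : R :=
  \sum_(n < N) b ^+ n * (`|x n| + `|l|).

Lemma normr_payoff_le b l N c x : 0 <= b ->
  `|payoff b l N c x| <= abs_payoff b l N x.
Proof.
move=> b0; apply: le_trans (ler_norm_sum _ _ _) _; apply: ler_sum => n _.
rewrite normrM; apply: ler_pM => //.
  rewrite ger0_norm ?mulr_ge0 ?exprn_ge0//.
  by rewrite ler_piMr ?exprn_ge0// indicE lern1; case: (_ \in _).
exact: ler_normB.
Qed.

Lemma integrable_abs_payoff {d} {T : measurableType d} (P : probability T R)
    (Y : nat -> T -> R) b l N :
  (forall i, (i < N)%N -> P.-integrable setT (fun w => (Y i w)%:E)) ->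
  P.-integrable setT (fun w => (abs_payoff b l N (fun i => Y i w))%:E).
Proof.
move=> iY; under eq_fun do rewrite /abs_payoff -sumEFin.
apply: integrable_sum => // n _; under eq_fun do rewrite EFinM.
apply: integrableZl => //; under eq_fun do rewrite EFinD.
apply: integrableD => //; first exact: (integrable_abse (iY n _)).
exact: finite_measure_integrable_cst.
Qed.

Lemma integrable_payoff {d} {T : measurableType d} (P : probability T R)
    (Y : nat -> T -> R) b l N c : 0 <= b ->
  (forall i, measurable_fun setT (Y i)) ->
  (forall i, (i < N)%N -> P.-integrable setT (fun w => (Y i w)%:E)) ->
  stopping_rule c ->
  P.-integrable setT (fun w => (payoff b l N c (fun i => Y i w))%:E).
Proof.
move=> b0 mY iY rc; apply: le_integrable (integrable_abs_payoff _ _ b l N iY) => //.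
  by apply/measurable_EFinP; exact: measurable_payoff.
move=> w _ /=; rewrite lee_fin; apply: le_trans (normr_payoff_le _ _ _ _ _ b0) _.
exact: ler_norm.
Qed.

End sequences.

(** * Laws of finitely many observations *)

Section law.
Context {R : realType}.
Implicit Types (s t : R) (b l : R) (N : nat).
Local Notation path := (path_space R).

Definition box N (B : nat -> set R) : set path :=
  [set x | forall i, (i < N)%N -> B i (x i)].

Definition boxes N : set (set path) :=
  [set box N B | B in [set B : nat -> set R | forall i, measurable (B i)]].

Lemma boxes_observable N : boxes N `<=` observable N.
Proof.
move=> _ [B mB <-].
have -> : box N B = \bigcap_(i in `I_N) [set x : path | B i (x i)].
  by apply/seteqP; split => x H i; exact: H.
have [s0 sC sU] := @observable_sigma_algebra R N.
rewrite -[X in observable _ X]setCK setC_bigcap -[X in observable _ X]setTD.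
apply: (sC).
rewrite bigcup_mkcond; apply: sU => i; case: ifPn => [|_] //.
rewrite inE/= => iN; rewrite -setTD; apply: (sC).
exact: observable_coordinate.
Qed.

Lemma observable_boxes N : observable N `<=` <<s boxes N >>.
Proof.
apply: sub_observable => [|i B iN mB]; first exact: smallest_sigma_algebra.
apply: sub_sigma_algebra; exists (fun j => if j == i then B else setT).
  by move=> j /=; case: ifP.
apply/seteqP; split => [x /(_ i iN)|x /= Bx j jN]; first by rewrite eqxx.
by case: eqP => // ->.
Qed.

Lemma setI_closed_boxes N : setI_closed (boxes N).
Proof.
move=> _ _ [B mB <-] [C mC <-]; exists (fun i => B i `&` C i).
  by move=> i; exact: measurableI.
apply/seteqP; split=> [x H|x [HB HC] i iN].
  by split=> i /H[].
by split; [exact: HB|exact: HC].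
Qed.

Section two_laws.
Context {d1} {T1 : measurableType d1} (P1 : probability T1 R) (Y1 : nat -> T1 -> R).
Context {d2} {T2 : measurableType d2} (P2 : probability T2 R) (Y2 : nat -> T2 -> R).
Variable N : nat.
Hypotheses (mY1 : forall i, measurable_fun setT (Y1 i))
  (mY2 : forall i, measurable_fun setT (Y2 i)).
Hypothesis eq_box : forall B, (forall i, measurable (B i)) ->
  P1 (\bigcap_(i < N) Y1 i @^-1` B i) = P2 (\bigcap_(i < N) Y2 i @^-1` B i).

(** Boxes form a pi-system generating the first [N] coordinates, so two processes
    that give the same mass to boxes have the same law there. *)
Lemma integral_eq_law (g : path -> R) :
  measurable_fun setT (g : g_sigma_algebraType (coordinate_sets N) -> R) ->
  P1.-integrable setT (fun w => (g (Y1 ^~ w))%:E) ->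
  P2.-integrable setT (fun w => (g (Y2 ^~ w))%:E) ->
  (\int[P1]_w (g (Y1 ^~ w))%:E = \int[P2]_w (g (Y2 ^~ w))%:E)%E.
Proof.
move=> mg i1 i2; pose S := g_sigma_algebraType (@coordinate_sets R N).
have m1 : measurable_fun setT ((fun w => Y1 ^~ w) : T1 -> S).
  by move=> _ A mA; rewrite setTI; exact: (measurable_observable _ N).
have m2 : measurable_fun setT ((fun w => Y2 ^~ w) : T2 -> S).
  by move=> _ A mA; rewrite setTI; exact: (measurable_observable _ N).
transitivity (\int[image_measure P1 m1]_x (g x)%:E)%E.
  by rewrite integral_pushforward//; exact/measurable_EFinP.
transitivity (\int[image_measure P2 m2]_x (g x)%:E)%E; last first.
  by rewrite integral_pushforward//; exact/measurable_EFinP.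
apply: eq_measure_integral => A mA _.
apply: (@g_sigma_algebra_measure_unique _ R S (boxes N) _ (fun=> setT)).
- exact: boxes_observable.
- by move=> i; exists (fun=> setT) => //; apply/seteqP; split.
- by rewrite bigcup_const.
- exact: setI_closed_boxes.
- move=> _ [B mB <-]; rewrite /= /pushforward.
  rewrite (_ : _ @^-1` _ = \bigcap_(i < N) Y1 i @^-1` B i) ?eq_box//.
- move=> k; rewrite /= /pushforward preimage_setT.
  by rewrite (le_lt_trans (probability_le1 _ _))// ltry.
- exact: observable_boxes.
Qed.

End two_laws.

(** Law of [N] observations that are independent [N(m, t i ^+ 2)] given a mean
    [m] drawn from [N(0, s ^+ 2)].  The mean is integrated out, since the gain of
    a stopping rule is a function of the observations only; the deviations
    depend on the observation so that they can be changed one at a time. *)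
Definition normal_mixture {d} {T : measurableType d} (P : {measure set T -> \bar R})
    (Y : nat -> T -> R) (N : nat) (t : nat -> R) (s : R) : Prop :=
  forall B : nat -> set R, (forall i, measurable (B i)) ->
    P (\bigcap_(i < N) Y i @^-1` B i) =
    (\int[normal_prob 0%R s]_m \prod_(i < N) normal_prob m (t i) (B i))%E.

(** The [i]-th observation is marginally [N(0, s ^+ 2 + t i ^+ 2)], by taking all
    other sides of the box equal to the whole line. *)
Lemma integral_norm_normal_mixture {d} {T : measurableType d} (P : probability T R)
    (Y : nat -> T -> R) N (t : nat -> R) s i : 0 < s -> (forall i, 0 < t i) ->
  (forall i, measurable_fun setT (Y i)) -> normal_mixture P Y N t s ->
  (i < N)%N ->
  (\int[P]_w `|(Y i w)%:E| =
   \int[normal_prob 0%R (Num.sqrt (s ^+ 2 + t i ^+ 2))]_x `|x%:E|)%E.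
Proof.
move=> s0 t0 mY mix iN.
pose r := Num.sqrt (s ^+ 2 + t i ^+ 2).
have mY' : measurable_fun setT (Y i : T -> measurableTypeR R) by exact: mY.
have E B : measurable B -> image_measure P mY' B = normal_prob 0 r B.
  move=> mB; rewrite -normal_prob_conv//.
  have := mix (fun j => if j == i then B else setT).
  rewrite (_ : \bigcap_(_ < _) _ = Y i @^-1` B); last first.
    apply/seteqP; split => [w /(_ i iN)|w Bw j jN]; rewrite /= ?eqxx//.
    by case: eqP => // ->.
  move=> H; etransitivity; first by apply: H => j; case: ifP.
  apply: eq_integral => m _; rewrite (bigD1 (Ordinal iN))//= eqxx big1 ?mule1//.
  move=> j ji; rewrite ifN; first exact: probability_setT.
  by apply: contra ji => /eqP ji; apply/eqP/val_inj.
transitivity (\int[image_measure P mY']_x `|x%:E|)%E; last first.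
  by apply: eq_measure_integral => A mA _; exact: E.
rewrite ge0_integral_pushforward//.
by do 2 apply: measurableT_comp => //.
Qed.

Lemma normal_mixture_integrable {d} {T : measurableType d} (P : probability T R)
    (Y : nat -> T -> R) N (t : nat -> R) s i : 0 < s -> (forall i, 0 < t i) ->
  (forall i, measurable_fun setT (Y i)) -> normal_mixture P Y N t s ->
  (i < N)%N -> P.-integrable setT (fun w => (Y i w)%:E).
Proof.
move=> s0 t0 mY mix iN; apply/integrableP; split.
  by apply/measurable_EFinP.
rewrite (integral_norm_normal_mixture _ _ _ _ _ _ s0 t0 mY mix iN).
have r0 : 0 < Num.sqrt (s ^+ 2 + t i ^+ 2).
  by rewrite sqrtr_gt0 addr_gt0// exprn_gt0.
by have /integrableP[] := integrable_normal_prob0 _ r0.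
Qed.

End law.

(** * Adding noise to the observations *)

Section noise.
Context {R : realType}.
Implicit Types (s : R) (b l : R) (N : nat).
Local Notation path := (path_space R).

Definition unprofitable {d} {T : measurableType d} (P : {measure set T -> \bar R})
    (Y : nat -> T -> R) (b l : R) (N : nat) : Prop :=
  forall c, stopping_rule c ->
    (\int[P]_w (payoff b l N c (Y ^~ w))%:E <= 0)%E.

Lemma emeasurable_prod d (T : measurableType d) (I : Type) (r : seq I) (p : pred I)
    (f : I -> T -> \bar R) :
  (forall i, measurable_fun setT (f i)) ->
  measurable_fun setT (fun w => \prod_(i <- r | p i) f i w)%E.
Proof.
move=> mf; elim: r => [|i r IH].
  by under eq_fun do rewrite big_nil; exact: measurable_cst.
under eq_fun do rewrite big_cons.
by case: (p i) => /=; [exact: (emeasurable_funM (mf i) IH)|exact: IH].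
Qed.

(** One observation, the [k]-th, is made noisier.  The noise is the first component
    of the product space, so that Fubini's theorem integrates over the original
    process first, for a fixed value of the noise. *)
Section step.
Context d (T : measurableType d) (P : probability T R) (Y : nat -> T -> R).
Variables (N k : nat) (t : nat -> R) (s t1 b l : R).
Hypotheses (s0 : 0 < s) (t0 : forall i, 0 < t i) (tk : t k <= t1)
  (b0 : 0 <= b) (kN : (k < N)%N).
Hypothesis mY : forall i, measurable_fun setT (Y i).
Hypothesis mixY : normal_mixture P Y N t s.
Hypothesis unpY : unprofitable P Y b l N.
Variable nu : probability (measurableTypeR R) R.
Hypotheses (inu : nu.-integrable setT (fun x => x%:E))
  (nu0 : (\int[nu]_x x%:E = 0)%E)
  (nuE : forall m B, measurable B ->
      (\int[nu]_z normal_prob (m + z)%R (t k) B = normal_prob m t1 B)%E).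

Let Y' i (p : measurableTypeR R * T) := shift_at k p.1 (Y ^~ p.2) i.
Let t' i := if i == k then t1 else t i.

Lemma measurable_noisy i : measurable_fun setT (Y' i).
Proof.
rewrite /Y' /shift_at; case: eqP => _.
  apply: measurable_funD; last exact: measurable_fst.
  exact: (measurableT_comp (mY i) measurable_snd).
exact: (measurableT_comp (mY i) measurable_snd).
Qed.

Lemma normal_mixture_noisy : normal_mixture (nu \x P)%E Y' N t' s.
Proof.
move=> B mB; rewrite /= /product_measure1.
(* for noise z the noisy box is the box for the original process whose k-th
   side is moved by - z *)
pose Bz z i := if i == k then (fun r => 1 * r + z) @^-1` B i else B i.
pose others m := (\prod_(i < N | i != Ordinal kN) normal_prob m (t i) (B i))%E.
pose f (p : R * R) := (normal_prob (p.2 + p.1)%R (t k) (B k) * others p.2)%E.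
have tN0 i : t i != 0 by rewrite gt_eqF.
have oth0 m : (0 <= others m)%E by apply: prode_ge0 => i _; exact: measure_ge0.
have moth : measurable_fun setT others.
  by apply: emeasurable_prod => i; apply: measurable_normal_prob_mean; rewrite ?gt_eqF.
have mN : measurable_fun setT (fun m => normal_prob m (t k) (B k)).
  by apply: measurable_normal_prob_mean => //; rewrite gt_eqF.
have mf : measurable_fun setT f.
  apply: emeasurable_funM.
    apply: (@measurableT_comp _ _ _ _ _ _ (fun m => normal_prob m (t k) (B k)) _
      (fun p : R * R => p.2 + p.1)) => //.
    exact: measurable_funD.
  exact: (measurableT_comp moth).
have f0 p : (0 <= f p)%E by rewrite mule_ge0.
transitivity (\int[nu]_z \int[normal_prob 0%R s]_m f (z, m))%E.
  apply: eq_integral => z _ /=.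
  rewrite (_ : xsection _ z = \bigcap_(i < N) Y i @^-1` Bz z i); last first.
    rewrite xsectionE; apply/seteqP; split => w H i iN; have := H i iN;
    by rewrite /= /Y' /Bz /shift_at; case: eqP => //=; rewrite mul1r.
  rewrite mixY; last first.
    by move=> i; rewrite /Bz; case: eqP => // _; exact: measurable_affine_preimage.
  apply: eq_integral => m _.
  have Ek : normal_prob m (t k) (Bz z k) = normal_prob (m + z) (t k) (B k).
    rewrite /Bz eqxx (normal_prob_affine m (t k) 1 z (B k) ltr01 (tN0 k) (mB k)).
    by rewrite !mul1r.
  have Eo : (\prod_(i < N | i != Ordinal kN) normal_prob m (t i) (Bz z i))%E = others m.
    by apply: eq_bigr => i ik; rewrite /Bz ifN.
  rewrite /f /fst /snd -Ek -Eo.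
  exact: (bigD1 (Ordinal kN) isT).
transitivity (\int[normal_prob 0%R s]_m \int[nu]_z f (z, m))%E.
  exact: (@fubini_tonelli _ _ _ _ R nu (normal_prob 0 s) f mf f0).
apply: eq_integral => m _; rewrite /f/=.
have mz : measurable_fun setT (fun z => normal_prob (m + z) (t k) (B k)).
  by apply: (measurableT_comp mN); exact: measurable_funD.
have z0 z : setT z -> (0 <= normal_prob (m + z) (t k) (B k))%E by move=> _; exact: measure_ge0.
rewrite (ge0_integralZr nu measurableT mz z0 (oth0 m)) (nuE m _ (mB k)).
have Ek : normal_prob m t1 (B k) = normal_prob m (t' k) (B k) by rewrite /t' eqxx.
have Eo : others m = (\prod_(i < N | i != Ordinal kN) normal_prob m (t' i) (B i))%E.
  by apply: eq_bigr => i ik; rewrite /t' ifN.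
by rewrite Ek Eo; apply/esym; exact: (bigD1 (Ordinal kN) isT).
Qed.

(** For fixed noise [z] the gain is that of a shifted rule, which is at most [0],
    plus [K * z] with [K] the discounted probability of taking observation [k];
    the mean of [K * z] over the noise is [0]. *)
Lemma unprofitable_noisy : unprofitable (nu \x P)%E Y' b l N.
Proof.
move=> c rc.
have t'0 i : 0 < t' i.
  by rewrite /t'; case: eqP => // _; exact: lt_le_trans (t0 k) tk.
have iY' i : (i < N)%N -> (nu \x P)%E.-integrable setT (fun p => (Y' i p)%:E).
  exact: (normal_mixture_integrable (nu \x P)%E Y' N t' s i s0 t'0
    measurable_noisy normal_mixture_noisy).
have iY i : (i < N)%N -> P.-integrable setT (fun w => (Y i w)%:E).
  exact: (normal_mixture_integrable P Y N t s i s0 t0 mY mixY).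
have ig : (nu \x P)%E.-integrable setT (fun p => (payoff b l N c (Y' ^~ p))%:E).
  apply: integrable_payoff => //; exact: measurable_noisy.
rewrite -(integral12_prod_meas1 ig).
pose h w : R := b ^+ k * \1_(c k) (Y ^~ w : path).
have mh : measurable_fun setT h.
  apply: measurable_funM => //.
  rewrite (_ : (fun w => _) = \1_[set w | c k (Y ^~ w)]); last first.
    by apply/funext => w; rewrite !indicE; congr (nat_of_bool _)%:R; apply/idP/idP; rewrite !inE.
  by apply: measurable_indic; apply: (measurable_observable Y k) => //; case: rc.
have ih : P.-integrable setT (EFin \o h).
  apply: le_integrable (finite_measure_integrable_cst P (b ^+ k) measurableT) => //.
    exact/measurable_EFinP.
  move=> w _; rewrite lee_fin normrM ler_piMr// indicE.
  by rewrite normr_nat lern1; case: (_ \in _).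
have hfin := integrable_fin_num measurableT ih.
pose K := fine (\int[P]_w (h w)%:E)%E.
have KE : (\int[P]_w (h w)%:E = K%:E)%E by rewrite fineK.
apply: (@le_trans _ _ (\int[nu]_z (K%:E * z%:E))%E); last first.
  by rewrite integralZl// nu0 mule0.
apply: le_integral => //.
- exact: integrable_fubini_F.
- exact: integrableZl.
move=> z _; rewrite /fubini_F/=.
have rcz := stopping_rule_shift_at k z c rc.
have E w : payoff b l N c (Y' ^~ (z, w)) =
    payoff b l N (fun n => shift_at k z @^-1` c n) (Y ^~ w) + h w * z.
  exact: payoff_shift_at.
under eq_integral do rewrite E EFinD EFinM.
have ihz : P.-integrable setT (fun w => (h w)%:E * z%:E)%E by exact: integrableZr.
rewrite integralD//=; last exact: integrable_payoff.
rewrite integralZr// KE -[leRHS]add0e leeD2r//.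
exact: unpY.
Qed.

End step.

Lemma noise_step {d} {T : measurableType d} (P : probability T R) (Y : nat -> T -> R)
    N k t s t1 b l :
  0 < s -> (forall i, 0 < t i) -> t k <= t1 -> 0 <= b -> (k < N)%N ->
  (forall i, measurable_fun setT (Y i)) ->
  normal_mixture P Y N t s -> unprofitable P Y b l N ->
  exists d' (T' : measurableType d') (P' : probability T' R) (Y' : nat -> T' -> R),
  [/\ forall i, measurable_fun setT (Y' i),
      normal_mixture P' Y' N (fun i => if i == k then t1 else t i) s &
      unprofitable P' Y' b l N].
Proof.
move=> s0 t0 tk b0 kN mY mixY unpY.
have [nu [inu nu0 nuE]] := exists_noise t1 (t k) (t0 k) tk.
exists _, _, (nu \x P)%E, (fun i p => shift_at k p.1 (Y ^~ p.2) i); split.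
- exact: measurable_noisy.
- exact: normal_mixture_noisy.
- exact: (unprofitable_noisy _ _ _ _ _ _ t s t1).
Qed.

Lemma noise_chain {d} {T : measurableType d} (P : probability T R) (Y : nat -> T -> R)
    N s t1 t2 b l :
  0 < s -> 0 < t2 -> t2 <= t1 -> 0 <= b ->
  (forall i, measurable_fun setT (Y i)) ->
  normal_mixture P Y N (fun=> t2) s -> unprofitable P Y b l N ->
  forall k, (k <= N)%N ->
  exists d' (T' : measurableType d') (P' : probability T' R) (Y' : nat -> T' -> R),
  [/\ forall i, measurable_fun setT (Y' i),
      normal_mixture P' Y' N (fun i => if (i < k)%N then t1 else t2) s &
      unprofitable P' Y' b l N].
Proof.
move=> s0 t20 t21 b0 mY mixY unpY; elim=> [_|k IH kN]; first by exists d, T, P, Y.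
have [d' [T' [P' [Y' [mY' mix' unp']]]]] := IH (ltnW kN).
have [||] := noise_step P' Y' N k _ s t1 b l s0 _ _ b0 kN mY' mix' unp'.
- by move=> i; case: ifP => // _; exact: lt_le_trans t21.
- by rewrite ltnn.
move=> d3 [T3 [P3 [Y3 [mY3 mix3 unp3]]]]; exists d3, T3, P3, Y3; split; [exact: mY3| |exact: unp3].
rewrite (_ : (fun i => _) = fun i => if i == k then t1 else if (i < k)%N then t1 else t2).
  exact: mix3.
by apply/funext => i; rewrite ltnS leq_eqVlt; case: eqP.
Qed.

Lemma measurable_payoff_path b l N c : stopping_rule c ->
  measurable_fun setT (payoff b l N c : g_sigma_algebraType (@coordinate_sets R N) -> R).
Proof.
move=> [oc _ _]; apply: measurable_sum => n.
have mn : measurable_fun setT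
    ((fun x => x n) : g_sigma_algebraType (@coordinate_sets R N) -> R).
  by move=> _ B mB; rewrite setTI; exact: observable_coordinate.
apply: measurable_funM; last exact: measurable_funB.
apply: measurable_funM => //; apply: measurable_indic.
exact: (le_observable _ _ (ltnW (ltn_ord n)) _ (oc n)).
Qed.

(** An inaccurate process is no more profitable than an accurate one.  They may
    live on different probability spaces: the accurate process with noise added
    to its first [N] observations has the law of the inaccurate one. *)
Lemma unprofitable_noisier {d1} {T1 : measurableType d1} (P1 : probability T1 R)
    (Y1 : nat -> T1 -> R) {d2} {T2 : measurableType d2} (P2 : probability T2 R)
    (Y2 : nat -> T2 -> R) N s t1 t2 b l :
  0 < s -> 0 < t2 -> t2 <= t1 -> 0 <= b ->
  (forall i, measurable_fun setT (Y1 i)) -> (forall i, measurable_fun setT (Y2 i)) ->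
  normal_mixture P1 Y1 N (fun=> t1) s -> normal_mixture P2 Y2 N (fun=> t2) s ->
  unprofitable P2 Y2 b l N -> unprofitable P1 Y1 b l N.
Proof.
move=> s0 t20 t21 b0 mY1 mY2 mix1 mix2 unp2.
have [d [T [P [Y [mY mix unp]]]]] :=
  noise_chain P2 Y2 N s t1 t2 b l s0 t20 t21 b0 mY2 mix2 unp2 N (leqnn N).
have t10 : 0 < t1 by exact: lt_le_trans t21.
have pos k : 0 < (if (k < N)%N then t1 else t2) by case: ifP.
move=> c rc.
have i1 := integrable_payoff P1 Y1 b l N c b0 mY1
  (fun i => normal_mixture_integrable P1 Y1 N (fun=> t1) s i s0 (fun=> t10) mY1 mix1) rc.
have i2 := integrable_payoff P Y b l N c b0 mY
  (fun i => normal_mixture_integrable P Y N _ s i s0 pos mY mix) rc.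
have eqb B : (forall i, measurable (B i)) ->
    P1 (\bigcap_(i < N) Y1 i @^-1` B i) = P (\bigcap_(i < N) Y i @^-1` B i).
  move=> mB; rewrite (mix1 B mB) (mix B mB); apply: eq_integral => m _.
  by apply: eq_bigr => i _; rewrite ltn_ord.
have := integral_eq_law P1 Y1 P Y N mY1 mY eqb _ (measurable_payoff_path b l N c rc) i1 i2.
by move=> ->; exact: unp.
Qed.

End noise.

(** * Stopping times and stopping rules *)

Section scale.
Context {R : realType}.
Local Notation path := (path_space R).

Lemma unprofitable_scale {d} {T : measurableType d} (P : probability T R)
    (Y : nat -> T -> R) (a b l : R) N : 0 < a -> 0 <= b ->
  (forall i, measurable_fun setT (Y i)) ->
  (forall i, (i < N)%N -> P.-integrable setT (fun w => (Y i w)%:E)) ->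
  unprofitable P Y b l N -> unprofitable P (fun i w => a * Y i w) b (a * l) N.
Proof.
move=> a0 b0 mY iY unp c [oc c0 dc].
pose c' n : set path := [set x : path | c n (fun i => a * x i)].
have rc' : stopping_rule c'.
  split=> [n||n x]; [|by apply/seteqP; split=> // x _; rewrite /c' /= c0|exact: dc].
  apply: (observable_map n (fun _ r => a * r)) => // _; exact: measurable_funM.
have E w : payoff b (a * l) N c (fun i => a * Y i w) = a * payoff b l N c' (Y ^~ w).
  rewrite /payoff mulr_sumr; apply: eq_bigr => n _.
  rewrite (_ : \1_(c' n) (Y ^~ w) = \1_(c n) (fun i => a * Y i w) :> R); first by ring.
  by rewrite !indicE; congr (nat_of_bool _)%:R; apply/idP/idP; rewrite !inE.
under eq_integral do rewrite E EFinM.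
rewrite integralZl//; last exact: integrable_payoff.
by rewrite mule_ge0_le0 ?unp// lee_fin ltW.
Qed.

End scale.

(** A decreasing sequence of decisions is determined by how many of them are
    positive. *)
Lemma ltn_sum_decreasing (p : nat -> bool) N n :
  (forall i, p i.+1 -> p i) ->
  (n < \sum_(i < N) p i)%N = (n < N)%N && p n.
Proof.
move=> dp; have le_p i j : (i <= j)%N -> p j -> p i.
  by move=> /subnK <-; elim: (j - i)%N => // m IH /dp.
elim: N => [|N IH]; first by rewrite big_ord0.
rewrite big_ord_recr/=; case: (boolP (p N)) => pN; last first.
  rewrite addn0 IH [in RHS]ltnS [in RHS]leq_eqVlt.
  by case: (eqVneq n N) => [->|//]; rewrite ltnn (negbTE pN).
rewrite (eq_bigr (fun=> 1%N)) => [|i _]; last first.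
  by rewrite (le_p i N) ?(ltnW (ltn_ord i)).
rewrite sum1_card card_ord addn1 ltnS.
by case: (leqP n N) => // nN; rewrite (le_p n N).
Qed.

Section stopping.
Context {R : realType} {d} {T : measurableType d} (P : probability T R).
Variable X : nat -> {RV P >-> R}.
Local Notation path := (path_space R).

Definition stopped (b l : R) (xi : T -> nat) (w : T) : R :=
  \sum_(n < xi w) b ^+ n * (X n w - l).

Definition admissible (xi : T -> nat) : Prop :=
  stopping_time (natural_filtration X) xi /\ forall w, (1 <= xi w)%N.

Lemma rule_stopping_time N c : (0 < N)%N -> stopping_rule c ->
  exists2 xi, admissible xi &
    forall b l w, stopped b l xi w = payoff b l N c (X ^~ w).
Proof.
move=> N0 [oc c0 dc].
pose p w n := `[< c n (X ^~ w : path) >].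
have dp w i : p w i.+1 -> p w i by move=> /asboolP/dc/asboolP.
(* xi counts the observations taken before the horizon *)
pose xi w := (\sum_(n < N) p w n)%N.
have xiE w n : (n < xi w)%N = (n < N)%N && p w n by exact: (ltn_sum_decreasing (p w) N n (dp w)).
exists xi.
  split=> [n|w]; last by rewrite xiE N0/=; apply/asboolP; rewrite c0.
  have [nN|nN] := ltnP n N; last first.
    rewrite (_ : [set w | _] = setT); last first.
      by apply/seteqP; split => // w _ /=; rewrite leqNgt xiE ltnNge nN.
    rewrite natural_filtrationE; exists setT => //; last by rewrite setTI preimage_setT.
    have [s0 sC _] := @observable_sigma_algebra R n.
    by rewrite -(setD0 setT); exact: sC.
  rewrite natural_filtrationE; exists (~` c n).
    have [_ sC _] := @observable_sigma_algebra R n.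
    by rewrite -setTD; exact: sC.
  rewrite setTI; apply/seteqP; split => w /=.
    by move=> H; rewrite leqNgt xiE nN/=; apply/negP => /asboolP.
  by rewrite leqNgt xiE nN/= => /negP H cn; apply: H; apply/asboolP.
move=> b l w; rewrite /stopped /payoff.
have xiN : (xi w <= N)%N by rewrite leqNgt xiE ltnn.
rewrite (big_ord_widen N (fun n => b ^+ n * (X n w - l)) xiN) big_mkcond/=.
apply: eq_bigr => n _; rewrite xiE ltn_ord/= /p indicE.
case: asboolP => cn; first by rewrite mem_set ?mulr1.
by rewrite memNset// mulr0 mul0r.
Qed.

(** Every event [xi <= n] is the inverse image of an observable set [A n]; these
    sets need not increase with [n] outside the range of the process, so the
    rule takes observation [n] outside all of [A 1, ..., A n]. *)
Lemma stopping_time_rule xi : admissible xi ->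
  exists2 c, stopping_rule c &
    forall n w, c n (X ^~ w) <-> (n < xi w)%N.
Proof.
move=> [xit xi1].
have H n : exists A, observable n A /\ forall w, A (X ^~ w) <-> (xi w <= n)%N.
  have := xit n; rewrite natural_filtrationE => -[A oA AE]; exists A; split=> // w.
  by rewrite setTI in AE; have := congr1 (fun B => B w) AE => /= ->.
have [A HA] := choice H.
exists (fun n => \bigcap_(k in [set k | 1 <= k <= n]%N) ~` A k).
  split=> [n||n x xc k /andP[k1 kn]].
  - have [s0 sC sU] := @observable_sigma_algebra R n.
    rewrite -[X in observable _ X]setCK setC_bigcap -[X in observable _ X]setTD.
    apply: (sC); rewrite bigcup_mkcond; apply: sU => k; case: ifPn => [|_]; last exact: s0.
    rewrite inE/= setCK => /andP[_ kn].
    exact: (le_observable k n kn _ (HA k).1).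
  - by apply/seteqP; split => // x _ k /= /andP[k1 k0]; have := leq_trans k1 k0.
  - by apply: xc; rewrite /= k1 leqW.
move=> n w; split=> [H'|nx k /= /andP[k1 kn] /(HA k).2]; last first.
  by move=> xk; have := leq_ltn_trans (leq_trans xk kn) nx; rewrite ltnn.
case: n H' => [_|n H']; first exact: xi1.
rewrite ltnNge; apply/negP => xn; have := H' n.+1.
by rewrite /= leqnn => /(_ isT); apply; apply/(HA n.+1).2.
Qed.

End stopping.

(** * The Gittins index as a critical charge *)

Section gittins.
Context {R : realType} {d} {T : measurableType d} (P : probability T R).
Variables (X : nat -> {RV P >-> R}) (b M : R).
Hypotheses (b0 : 0 < b) (b1 : b < 1) (M0 : 0 <= M).
Hypothesis EX : forall n, (\int[P]_w `|(X n w)%:E| <= M%:E)%E.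
Implicit Types (l : R) (xi : T -> nat).

Let mX n : measurable_fun setT (X n : T -> R). Proof. exact: measurable_funPT. Qed.

Lemma integrable_observation n : P.-integrable setT (fun w => (X n w)%:E).
Proof.
apply/integrableP; split; first exact/measurable_EFinP.
exact: le_lt_trans (EX n) (ltry _).
Qed.

(** Dominates the gain of every stopping rule at every horizon; the uniform bound
    [M] on the first absolute moments makes its mean a geometric series. *)
Let envelope l w : \bar R := (\sum_(0 <= n <oo) (b ^+ n * (`|X n w| + `|l|))%:E)%E.

Lemma integrable_envelope l : P.-integrable setT (envelope l).
Proof.
have b0' := ltW b0.
have u0 n w : (0 <= (b ^+ n * (`|X n w| + `|l|))%:E)%E.
  by rewrite lee_fin mulr_ge0 ?exprn_ge0// addr_ge0.
have mu n : measurable_fun setT (fun w => (b ^+ n * (`|X n w| + `|l|))%:E).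
  apply/measurable_EFinP; apply: measurable_funM => //.
  apply: measurable_funD => //; exact: measurableT_comp.
have env0 w : (0 <= envelope l w)%E by apply: nneseries_ge0 => n _ _; exact: u0.
apply/integrableP; split.
  by apply: ge0_emeasurable_sum => // n w _ _; exact: u0.
under eq_integral do rewrite gee0_abs//.
rewrite integral_nneseries//.
apply: (@le_lt_trans _ _ (\sum_(0 <= n <oo) (b ^+ n * (M + `|l|))%:E)%E).
  apply: lee_nneseries => [n _ _|n _]; first by apply: integral_ge0 => w _; exact: u0.
  under eq_integral do rewrite EFinM.
  rewrite ge0_integralZl//; last 2 first.
  - apply/measurable_EFinP; apply: measurable_funD => //; exact: measurableT_comp.
  - by rewrite lee_fin exprn_ge0.
  rewrite EFinM; apply: lee_wpmul2l; first by rewrite lee_fin exprn_ge0.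
  under eq_integral do rewrite EFinD.
  rewrite ge0_integralD//; last first.
    by apply/measurable_EFinP; exact: measurableT_comp.
  rewrite EFinD integral_cst// [X in (_ * X)%E]probability_setT mule1 leeD2r//.
  exact: EX.
apply: (@le_lt_trans _ _ ((M + `|l|) / (1 - b))%:E); last exact: ltry.
apply: lime_le.
  apply: is_cvg_nneseries => n _ _.
  by rewrite lee_fin mulr_ge0 ?exprn_ge0// addr_ge0.
near=> k; rewrite sumEFin lee_fin.
have := @geometric_le_lim R k (M + `|l|) b.
rewrite addr_ge0// ger0_norm// => /(_ isT b0 b1); apply: le_trans.
by rewrite /series/= le_eqVlt; apply/orP; left; apply/eqP; apply: eq_bigr => i _; rewrite mulrC.
Unshelve. all: by end_near. Qed.

Section stop.
Variables (xi : T -> nat) (adm : admissible P X xi).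

(** The gains at finite horizons are eventually equal to [stopped] at each point,
    since [xi] is finite there, and they are dominated by [envelope]. *)
Lemma integral_stopped l :
  P.-integrable setT (fun w => (stopped P X b l xi w)%:E) /\
  ((forall N, unprofitable P X b l N) ->
    (\int[P]_w (stopped P X b l xi w)%:E <= 0)%E).
Proof.
have b0' := ltW b0.
have [c rc cE] := stopping_time_rule P X xi adm.
pose f N w := (payoff b l N c (X ^~ w))%:E.
have mf N : measurable_fun setT (f N).
  by apply/measurable_EFinP; exact: measurable_payoff.
have fcvg w : f N w @[N --> \oo] --> (stopped P X b l xi w)%:E.
  apply: cvg_near_cst; near=> N; rewrite /f; congr _%:E.
  have xiN : (xi w <= N)%N by near: N; exact: nbhs_infty_ge.
  rewrite /stopped /payoff (big_ord_widen N (fun n => b ^+ n * (X n w - l)) xiN).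
  rewrite [in RHS]big_mkcond/=.
  apply: eq_bigr => n _; rewrite indicE; case: ifPn => nx.
    by rewrite mem_set ?mulr1//; exact/cE.
  by rewrite memNset ?mulr0 ?mul0r// => /cE; exact/negP.
have dom w N : (`|f N w| <= envelope l w)%E.
  rewrite /f abse_EFin; apply: (@le_trans _ _ (abs_payoff b l N (X ^~ w))%:E).
    by rewrite lee_fin; exact: normr_payoff_le.
  rewrite /abs_payoff -sumEFin -(big_mkord xpredT (fun n => (b ^+ n * (`|X n w| + `|l|))%:E)).
  apply: nneseries_lim_ge => n _ _.
  by rewrite lee_fin mulr_ge0 ?exprn_ge0// addr_ge0.
have ms : measurable_fun setT (fun w => (stopped P X b l xi w)%:E).
  by apply: (emeasurable_fun_cvg _ _ mf) => w _; exact: fcvg.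
have [i _ lim] := dominated_convergence measurableT mf ms
  (aeW _ (fun w _ => fcvg w)) (integrable_envelope l) (aeW _ (fun w n _ => dom w n)).
split=> // unp; rewrite -(cvg_lim _ lim)//; apply: lime_le.
  by apply/cvg_ex; eexists; exact: lim.
by near=> N; exact: unp.
Unshelve. all: by end_near. Qed.

(** The numerator and the denominator of the ratio defining the index; the gain
    for a charge [l] is affine in [l], so both are obtained from the integrability
    of the gains for the charges [0] and [1]. *)
Lemma stopped_moments : exists S D : R,
  [/\ ('E_P[fun w => (\sum_(n < xi w) b ^+ n * X n w)%R] = S%:E)%E,
      ('E_P[fun w => (\sum_(n < xi w) b ^+ n)%R] = D%:E)%E, 1 <= D &
      forall l, (\int[P]_w (stopped P X b l xi w)%:E)%E = (S - l * D)%:E].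
Proof.
have b0' := ltW b0.
have [iS _] := integral_stopped 0; have [iS1 _] := integral_stopped 1.
pose den w : R := \sum_(n < xi w) b ^+ n.
have SE w : (\sum_(n < xi w) b ^+ n * X n w)%R = stopped P X b 0 xi w.
  by apply: eq_bigr => n _; rewrite subr0.
have stoppedE l w : stopped P X b l xi w = stopped P X b 0 xi w - l * den w.
  rewrite /stopped /den mulr_sumr -sumrB; apply: eq_bigr => n _.
  by rewrite subr0 mulrBr [l * _]mulrC.
have iD : P.-integrable setT (fun w => (den w)%:E).
  rewrite (_ : (fun w => _) = fun w => ((stopped P X b 0 xi w)%:E - (stopped P X b 1 xi w)%:E)%E).
    exact: integrableB.
  by apply/funext => w; rewrite -EFinB [in RHS](stoppedE 1); congr _%:E; ring.
have Sfin := integrable_fin_num measurableT iS.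
have Dfin := integrable_fin_num measurableT iD.
exists (fine (\int[P]_w (stopped P X b 0 xi w)%:E)%E), (fine (\int[P]_w (den w)%:E)%E); split.
- rewrite unlock fineK//; apply: eq_integral => w _; by rewrite SE.
- by rewrite unlock fineK.
- rewrite -lee_fin fineK//.
  rewrite -(probability_setT P) -[X in (X <= _)%E]mul1e -integral_cst//.
  apply: ge0_le_integral => //.
  + exact: measurable_int iD.
  move=> w _; rewrite lee_fin /den.
  have := adm.2 w; case: (xi w) => // m _.
  by rewrite big_ord_recl expr0 lerDl sumr_ge0// => n _; exact: exprn_ge0.
- move=> l; under eq_integral do rewrite stoppedE EFinB EFinM.
  rewrite integralB//; last exact: integrableZl.
  by rewrite integralZl// EFinB EFinM !fineK.
Qed.

End stop.

(** Since the denominator is positive, a ratio is at most [l] exactly when its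
    stopping time does not gain from the charge [l]. *)
Lemma gittins_index_le l : (forall N, unprofitable P X b l N) ->
  (gittins_index X b <= l%:E)%E.
Proof.
move=> unp; apply: ge_ereal_sup => _ [xi adm <-].
have [S [D [-> -> D1 E]]] := stopped_moments xi adm.
have D0 : 0 < D by exact: lt_le_trans D1.
have := (integral_stopped xi adm l).2 unp; rewrite E lee_fin subr_le0 => Sle.
by rewrite inver gt_eqF// lee_pdivrMr// -EFinM lee_fin.
Qed.

Lemma gittins_index_unprofitable g N : gittins_index X b = g%:E ->
  unprofitable P X b g N.
Proof.
move=> gE c rc; have [->|N0] := posnP N.
  under eq_integral do rewrite /payoff big_ord0.
  by rewrite integral0.
have [xi adm xiE] := rule_stopping_time P X N c N0 rc.
have [S [D [ES ED D1 E]]] := stopped_moments xi adm.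
have D0 : 0 < D by exact: lt_le_trans D1.
under eq_integral do rewrite -xiE.
rewrite E lee_fin subr_le0 -lee_fin EFinM -lee_pdivrMr//.
rewrite -gE; apply: ereal_sup_ubound; exists xi => //.
by rewrite ES ED inver gt_eqF.
Qed.

Lemma gittins_index_gtNy : (-oo < gittins_index X b)%E.
Proof.
have adm : admissible P X (fun=> 1%N).
  split=> // n; rewrite natural_filtrationE.
  have [s0 sC _] := @observable_sigma_algebra R n.
  case: n s0 sC => [|n] s0 sC.
    by exists set0; [exact: s0|rewrite setTI preimage_set0; apply/seteqP; split].
  exists (setT `\` set0); first exact: sC.
  by rewrite setTI setD0 preimage_setT; apply/seteqP; split.
have [S [D [ES ED D1 E]]] := stopped_moments _ adm.
have D0 : 0 < D by exact: lt_le_trans D1.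
apply: (@lt_le_trans _ _ (S%:E / D%:E)%E).
  by rewrite inver gt_eqF// -EFinM ltNyr.
by apply: ereal_sup_ubound; exists (fun=> 1%N) => //; rewrite ES ED.
Qed.

End gittins.

(** * Normal reward processes *)

Section process.
Context {R : realType}.

Lemma measurable_prod_normal_prob N (t : nat -> R) (B : nat -> set R) :
  (forall i, 0 < t i) -> (forall i, measurable (B i)) ->
  measurable_fun setT (fun m => \prod_(i < N) normal_prob m (t i) (B i))%E.
Proof.
move=> t0 mB; apply: emeasurable_prod => i.
by apply: measurable_normal_prob_mean => //; rewrite gt_eqF.
Qed.

Lemma normal_mixture_scale {d} {T : measurableType d} (P : probability T R)
    (Y : nat -> T -> R) N (t : nat -> R) (s a : R) :
  0 < a -> s != 0 -> (forall i, 0 < t i) -> normal_mixture P Y N t s ->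
  normal_mixture P (fun i w => a * Y i w) N (fun i => a * t i) (a * s).
Proof.
move=> a0 s0 t0 mix B mB.
have maff : measurable_fun setT
    ((fun x => a * x + 0) : measurableTypeR R -> measurableTypeR R).
  exact: measurable_affine.
pose F m := (\prod_(i < N) normal_prob m (a * t i)%R (B i))%E.
have mF : measurable_fun setT F.
  by apply: (measurable_prod_normal_prob N (fun i => a * t i)) => // i; rewrite mulr_gt0.
have F0 m : (0 <= F m)%E by apply: prode_ge0 => i _; exact: measure_ge0.
transitivity (\int[normal_prob 0%R s]_m F (a * m + 0)%R)%E.
  transitivity (P (\bigcap_(i < N) Y i @^-1` ((fun x => a * x + 0) @^-1` B i))).
    congr (P _); apply: eq_bigcapr => i _.
    by apply/funext => w; rewrite /= addr0.
  rewrite mix; last by move=> i; exact: measurable_affine_preimage.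
  apply: eq_integral => m _; apply: eq_bigr => i _.
  by rewrite normal_prob_affine// gt_eqF.
transitivity (\int[image_measure (normal_prob 0 s) maff]_m F m)%E.
  apply/esym.
  exact: (ge0_integral_pushforward maff (normal_prob 0 s) measurableT mF (fun m _ => F0 m)).
apply: eq_measure_integral => A mA _; rewrite /= /pushforward.
by rewrite (normal_prob_affine 0 s a 0 A a0 s0 mA) mulr0 addr0.
Qed.

Lemma normal_reward_process_mixture {d} {T : measurableType d} (P : probability T R)
    (theta : {RV P >-> R}) (X : nat -> {RV P >-> R}) (v s2 : R) N :
  0 < v -> 0 < s2 -> normal_reward_process theta X 0 v s2 ->
  normal_mixture P X N (fun=> Num.sqrt s2) (Num.sqrt v).
Proof.
move=> v0 s20 [htheta hX] B mB.
have := hX N setT B measurableT mB; rewrite preimage_setT setTI => hXB.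
have mtheta0 : measurable_fun setT (theta : T -> R) by exact: measurable_funPT.
have mtheta : measurable_fun setT (theta : T -> measurableTypeR R) by exact: mtheta0.
pose F m := (\prod_(i < N) normal_prob m (Num.sqrt s2) (B i))%E.
have mF : measurable_fun setT F.
  by apply: (measurable_prod_normal_prob N (fun=> Num.sqrt s2)) => // i; rewrite sqrtr_gt0.
have F0 m : (0 <= F m)%E by apply: prode_ge0 => i _; exact: measure_ge0.
apply: (eq_trans hXB).
transitivity (\int[image_measure P mtheta]_m F m)%E.
  apply/esym.
  exact: (ge0_integral_pushforward mtheta P measurableT mF (fun m _ => F0 m)).
by apply: eq_measure_integral => A mA _; exact: htheta.
Qed.

End process.

Theorem theorem1 (R : realType) (s2 b : R) (hs2 : 0 < s2)
    (hb0 : 0 < b) (hb1 : b < 1)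
    (v1 v2 : R) (hv1 : 0 < v1) (hv12 : v1 <= v2)
    (d1 : measure_display) (T1 : measurableType d1) (P1 : probability T1 R)
    (theta1 : {RV P1 >-> R}) (X1 : nat -> {RV P1 >-> R})
    (h1 : normal_reward_process theta1 X1 0 v1 s2)
    (d2 : measure_display) (T2 : measurableType d2) (P2 : probability T2 R)
    (theta2 : {RV P2 >-> R}) (X2 : nat -> {RV P2 >-> R})
    (h2 : normal_reward_process theta2 X2 0 v2 s2) :
  (gittins_index X1 b / (Num.sqrt v1)%:E
     <= gittins_index X2 b / (Num.sqrt v2)%:E)%E.
Proof.
have hv2 : 0 < v2 by exact: lt_le_trans hv12.
have s0 : 0 < Num.sqrt s2 by rewrite sqrtr_gt0.
have r1 : 0 < Num.sqrt v1 by rewrite sqrtr_gt0.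
have r2 : 0 < Num.sqrt v2 by rewrite sqrtr_gt0.
have mix1 N := normal_reward_process_mixture P1 theta1 X1 v1 s2 N hv1 hs2 h1.
have mix2 N := normal_reward_process_mixture P2 theta2 X2 v2 s2 N hv2 hs2 h2.
have mX1 i : measurable_fun setT (X1 i : T1 -> R) by exact: measurable_funPT.
have mX2 i : measurable_fun setT (X2 i : T2 -> R) by exact: measurable_funPT.
have moment v : 0 < v -> exists2 M : R, 0 <= M &
    (\int[normal_prob 0%R (Num.sqrt (Num.sqrt v ^+ 2 + Num.sqrt s2 ^+ 2))]_x `|x%:E|)%E = M%:E.
  move=> v0; set r := Num.sqrt (_ + _).
  have r0 : 0 < r by rewrite sqrtr_gt0 addr_gt0// exprn_gt0// sqrtr_gt0.
  have fi : (\int[normal_prob 0%R r]_x `|x%:E|)%E \is a fin_num.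
    exact: (integrable_fin_num measurableT (integrable_abse (integrable_normal_prob0 r r0))).
  exists (fine (\int[normal_prob 0%R r]_x `|x%:E|)%E); last by rewrite fineK.
  by apply: fine_ge0; apply: integral_ge0 => x _; exact: abse_ge0.
have [M1 M10 EM1] := moment v1 hv1; have [M2 M20 EM2] := moment v2 hv2.
have EX1 n : (\int[P1]_w `|(X1 n w)%:E| <= M1%:E)%E.
  rewrite -EM1 (integral_norm_normal_mixture P1 X1 n.+1 (fun=> Num.sqrt s2) (Num.sqrt v1) n)//.
have EX2 n : (\int[P2]_w `|(X2 n w)%:E| <= M2%:E)%E.
  rewrite -EM2 (integral_norm_normal_mixture P2 X2 n.+1 (fun=> Num.sqrt s2) (Num.sqrt v2) n)//.
(* the index of X2 is not -oo, and nothing is to be proved when it is +oo *)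
have := gittins_index_gtNy P2 X2 b M2 hb0 hb1 M20 EX2.
case g2E : (gittins_index X2 b) => [g| |]// _; last first.
  by rewrite [X in (_ <= +oo * X)%E]inver gt_eqF// gt0_mulye ?leey// lte_fin invr_gt0.
pose a := Num.sqrt v1 / Num.sqrt v2.
have a0 : 0 < a by rewrite divr_gt0.
have a1 : a <= 1 by rewrite ler_pdivrMr// mul1r ler_wsqrtr.
have av2 : a * Num.sqrt v2 = Num.sqrt v1 by rewrite divfK// gt_eqF.
have unp1 N : unprofitable P1 X1 b (a * g) N.
  have mix2' := normal_mixture_scale P2 X2 N _ _ a a0 (lt0r_neq0 r2) (fun=> s0) (mix2 N).
  rewrite av2 in mix2'.
  apply: (unprofitable_noisier P1 X1 P2 (fun i w => a * X2 i w) N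
    (Num.sqrt v1) (Num.sqrt s2) (a * Num.sqrt s2) b (a * g) r1 _ _ (ltW hb0) mX1 _ (mix1 N) mix2').
  - by rewrite mulr_gt0.
  - by rewrite ler_piMl// ltW.
  - by move=> i; exact: measurable_funM.
  apply: unprofitable_scale => //; first exact: ltW.
    by move=> i _; exact: (integrable_observation P2 X2 M2 EX2).
  exact: (gittins_index_unprofitable P2 X2 b M2 hb0 hb1 M20 EX2 g N g2E).
have := gittins_index_le P1 X1 b M1 hb0 hb1 M10 EX1 (a * g) unp1 => g1le.
rewrite !inver !gt_eqF// -EFinM lee_pdivrMr//; apply: le_trans g1le _.
by rewrite -!EFinM lee_fin /a le_eqVlt; apply/orP; left; apply/eqP; ring.
Qed.
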